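(* Let $\{X_n\}_{n\ge 0}$ be a $\phi$-irreducible ergodic Markov chain on a state space $\mathcal{X}$ with stationary distribution $\pi$ (and arbitrary initial distribution), let $h:\mathcal{X}\to\mathbb{R}$ be measurable with $\pi(h)=\int_{\mathcal X} h\,d\pi$ finite, and let $e_n=\frac1n\sum_{i=1}^n h(X_i)$. Suppose that for some fixed $n\in\mathbb{N}=\{1,2,\dots\}$ we have $E(|e_n-\pi(h)|)\le\gamma_n$ for some constant $\gamma_n>0$. Then for any $\alpha\in(0,1)$, the interval $I_n:=(e_n-\gamma_n\alpha^{-1},\ e_n+\gamma_n\alpha^{-1})$ satisfies $$P[\pi(h)\in I_n]\ \ge\ 1-\alpha.$$
   Context: $\mathcal{X}$ is a general measurable state space and the chain is time-homogeneous with $n$-step transition kernels $P^n(x,\cdot)$. The chain is $\phi$-irreducible if there is a nonzero $\sigma$-finite measure $\phi$ on $\mathcal{X}$ such that for every measurable $A$ with $\phi(A)>0$ and every $x\in\mathcal{X}$ there is $n\in\mathbb{N}$ with $P^n(x,A)>0$. Ergodic means that $\pi$ is a stationary probability distribution and $\lim_{n\to\infty}\|P^n(x,\cdot)-\pi(\cdot)\|=0$ for $\pi$-a.e. $x\in\mathcal{X}$, where $\|\mu-\nu\|=\sup_A|\mu(A)-\nu(A)|$ is total variation distance. $P$ and $E$ refer to the law of the chain under its given initial distribution. *)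

(* Defs.v *)
From HB Require Import structures.
From mathcomp Require Import all_boot all_order all_algebra.
From mathcomp Require Import all_classical all_reals all_analysis.

Set Implicit Arguments.
Unset Strict Implicit.
Unset Printing Implicit Defensive.
Import Order.TTheory GRing.Theory Num.Theory.
Import numFieldNormedType.Exports.

Local Open Scope classical_set_scope.
Local Open Scope ring_scope.
Local Open Scope ereal_scope.

Fixpoint nstep (R : realType) (d : measure_display) (S : measurableType d)
    (K : R.-pker S ~> S) (n : nat) : R.-spker S ~> S :=
  if n is m.+1 then mkcomp_noparam K (nstep K m)
  else kdirac (@measurable_id _ S setT).

Definition tv_dist (R : realType) (d : measure_display) (S : measurableType d)
    (mu nu : set S -> \bar R) : \bar R :=
  ereal_sup [set `|mu A - nu A| | A in measurable].

(* The witness number of steps is at least 1. *)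
Definition phi_irreducible (R : realType) (d : measure_display)
    (S : measurableType d) (K : R.-pker S ~> S) : Prop :=
  exists phi : {sigma_finite_measure set S -> \bar R},
    phi [set: S] != 0 /\
    forall A : set S, measurable A -> 0 < phi A ->
      forall x : S, exists n : nat, (0 < n)%N /\ 0 < nstep K n x A.

Definition stationary (R : realType) (d : measure_display)
    (S : measurableType d) (K : R.-pker S ~> S) (pi : probability S R) : Prop :=
  forall A : set S, measurable A -> \int[pi]_x K x A = pi A.

Definition ergodic (R : realType) (d : measure_display)
    (S : measurableType d) (K : R.-pker S ~> S) (pi : probability S R) : Prop :=
  stationary K pi /\
  {ae pi, forall x, tv_dist (nstep K n x) pi @[n --> \oo] --> 0}.

Definition natural_filtration (dO d : measure_display) (Omega : measurableType dO)
    (S : measurableType d) (X : nat -> Omega -> S) (n : nat) : set (set Omega) :=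
  <<s \bigcup_(i in `I_n.+1) preimage_set_system setT (X i) measurable >>.

(* Time-homogeneous Markov property, P(X_{n+1} \in B | X_0, ..., X_n) = K(X_n, B)
   a.s., with the conditional probability given by its defining integral
   identity; the law of X_0 is unconstrained. *)
Definition markov_chain (R : realType) (dO d : measure_display)
    (Omega : measurableType dO) (S : measurableType d) (P : probability Omega R)
    (K : R.-pker S ~> S) (X : nat -> {RV P >-> S}) : Prop :=
  forall (n : nat) (F : set Omega) (B : set S),
    natural_filtration (fun i => X i) n F -> measurable B ->
    P (F `&` X n.+1 @^-1` B) = \int[P]_(w in F) K (X n w) B.

Definition ergodic_average (R : realType) (Omega S : Type)
    (h : S -> R) (X : nat -> Omega -> S) (n : nat) (w : Omega) : R :=
  (n%:R^-1 * \sum_(1 <= i < n.+1) h (X i w))%R.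

(* Main.v *)
Require Import Defs.
From HB Require Import structures.
From mathcomp Require Import all_boot all_order all_algebra.
From mathcomp Require Import all_classical all_reals all_analysis.
From mathcomp Require Import measurable_realfun.

Import Order.TTheory GRing.Theory Num.Theory.
Import numFieldNormedType.Exports.

Local Open Scope classical_set_scope.
Local Open Scope ring_scope.

(** The statement is Markov's inequality for the error of the ergodic average
    [e_n]: with [m] the [pi]-mean of [h] and [c = gamma / alpha],

      [P(|e_n - m| >= c) <= E|e_n - m| / c <= gamma / c = alpha],

    so the complementary event [|e_n - m| < c], which says exactly that [m] lies
    in the open interval of radius [c] about [e_n], has probability at least
    [1 - alpha]. The inequality is proved for an arbitrary real random variable
    and an arbitrary centre in [probability_ball_ge_mean_dist];
    [measurable_ergodic_average] makes [e_n] such a random variable. *)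

Lemma measurable_ergodic_average (R : realType) (dO d : measure_display)
    (Omega : measurableType dO) (S : measurableType d)
    (h : S -> R) (X : nat -> Omega -> S) (n : nat) :
  measurable_fun [set: S] h -> (forall i, measurable_fun [set: Omega] (X i)) ->
  measurable_fun [set: Omega] (ergodic_average h X n).
Proof.
move=> mh mX; apply: measurable_funM; first exact: measurable_cst.
by apply: measurable_sum => i; exact: measurableT_comp.
Qed.

(** Markov's inequality, read on the complement of the tail event. The radius
    [gamma / alpha] is the one at which the bound [gamma / radius] on the tail
    equals [alpha]. *)
Lemma probability_ball_ge_mean_dist (R : realType) (d : measure_display)
    (T : measurableType d) (P : probability T R) (Y : T -> R) (m gamma alpha : R) :
  measurable_fun [set: T] Y -> 0 < gamma -> 0 < alpha ->
  ('E_P[(fun w => `|Y w - m|)%R] <= gamma%:E)%E ->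
  ((1 - alpha)%:E <= P [set w | (`|Y w - m| < gamma * alpha^-1)%R])%E.
Proof.
move=> mY gamma_gt0 alpha_gt0 mean_le; set c := gamma * alpha^-1.
have c_gt0 : 0 < c by rewrite divr_gt0.
have mYm : measurable_fun [set: T] (fun w => Y w - m) by exact: measurable_funB.
pose D : {RV P >-> R} := HB.pack (fun w => Y w - m)
  (isMeasurableFun.Build _ _ _ _ (fun w => Y w - m) mYm).
pose tail := [set w | c <= `|Y w - m|].
have mtail : measurable tail.
  rewrite -[tail]setTI; apply: measurable_fun_le; first by [].
    exact: measurable_cst.
  exact: measurableT_comp.
have tail_le : (P tail <= alpha%:E)%E.
  rewrite -(@lee_pmul2l _ c%:E) ?lte_fin//.
  have -> : (c%:E * alpha%:E = gamma%:E)%E by rewrite -EFinM divfK// gt_eqF.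
  apply: le_trans mean_le.
  exact: (markov D c_gt0 (@measurable_id _ _ setT) (fun r => id)
    (fun x y _ _ => id)).
have -> : [set w | `|Y w - m| < c] = ~` tail.
  by apply/seteqP; split=> w /=; rewrite ltNge => /negP.
by rewrite probability_setC// EFinB leeB.
Qed.

Theorem theorem3 (R : realType) (dO d : measure_display)
    (Omega : measurableType dO) (P : probability Omega R)
    (S : measurableType d) (K : R.-pker S ~> S) (pi : probability S R)
    (X : nat -> {RV P >-> S})
    (X_markov : markov_chain K X)
    (K_irreducible : phi_irreducible K)
    (K_ergodic : ergodic K pi)
    (h : S -> R) (h_measurable : measurable_fun [set: S] h)
    (h_integrable : pi.-integrable [set: S] (EFin \o h))
    (n : nat) (n_gt0 : (0 < n)%N) (gamma : R) (gamma_gt0 : 0 < gamma)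
    (mean_error_le :
      ('E_P[(fun w => `|ergodic_average h (fun i => X i) n w
                        - \int[pi]_x h x|)%R] <= gamma%:E)%E)
    (alpha : R) (alpha_gt0 : 0 < alpha) (alpha_lt1 : alpha < 1) :
  ((1 - alpha)%:E <=
    P [set w | (\int[pi]_x h x)%R \in
        `](ergodic_average h (fun i => X i) n w - gamma * alpha^-1)%R,
          (ergodic_average h (fun i => X i) n w + gamma * alpha^-1)%R[ ])%E.
Proof.
have mE := measurable_ergodic_average _ _ _ _ _ _ (fun i => X i) n
  h_measurable (fun i => measurable_funPT (X i)).
have := probability_ball_ge_mean_dist _ _ _ _ _ _ _ _ mE gamma_gt0 alpha_gt0
  mean_error_le.
congr (_ <= P _)%E.
by apply/seteqP; split=> w /=; rewrite in_itv/= ltr_distlC.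
Qed.
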